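(* For every $H\in\mathcal C$, the predominated graph $(H,V(H)\setminus X(H))$ is an atomic MBD critical graph.
   Context: For a tree $T$, $S(T)$ is obtained by subdividing each edge of $T$ exactly once; $\mathcal S=\{S(T):T\text{ a tree}\}$ and $X(S(T))=V(T)$ (with $S(P_1)=P_1$, $X(P_1)=V(P_1)$). The double-odd replacement of an edge $xy$ of a graph removes $xy$ and adds two internally vertex-disjoint $x,y$-paths, both of odd length (if both have length $1$ this is the same as keeping the single edge $xy$). For $F\in\mathcal S$, an $F$-cactus is a cactus graph $H$ that is either $F$ or obtained from $F$ by double-odd replacements of some edges of $F$; $H$ is bipartite and $X(H)$ is the bipartition class of $H$ containing $X(F)$. $\mathcal C$ is the set of all $F$-cacti over all $F\in\mathcal S$. A predominated graph is a pair $(G,D)$ with $D\subseteq V(G)$; in the MBD game on $(G,D)$, Staller and Dominator alternately claim unclaimed vertices of $V(G)$ (including vertices of $D$), Staller first, until all are claimed; Staller wins if she claims all of $N_G[v]$ for some $v\in V(G)\setminus D$, Dominator wins otherwise. $(G,D)$ is MBD critical if Staller wins on $(G,D)$ but Dominator wins on $(G,D\cup\{v\})$ for every $v\in V(G)\setminus D$; it is atomic MBD critical if moreover $D$ is independent in $G$ and no vertex of $D$ is isolated in $G$. *)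

(* Defs.v *)
From mathcomp Require Import all_boot.
Set Implicit Arguments.
Unset Strict Implicit.
Unset Printing Implicit Defensive.

Definition simple_graph (V : finType) (adj : rel V) : Prop :=
  symmetric adj /\ irreflexive adj.

Definition is_tree (T : finType) (eT : rel T) : Prop :=
  [/\ simple_graph eT, 0 < #|T|,
      (forall x y : T, connect eT x y) &
      (forall (x : T) (p : seq T), 2 <= size p -> uniq (x :: p) -> ~~ cycle eT (x :: p))].

Definition cnbhd (V : finType) (adj : rel V) (v : V) : {set V} :=
  [set u | (u == v) || adj v u].

Section Cactus.
Variables (T : finType) (eT : rel T).

Definition is_tedge (A : {set T}) : bool :=
  [exists x, exists y, eT x y && (A == [set x; y])].

Definition tedge := {A : {set T} | is_tedge A}.

(* vertices of F = S(T): the vertices of T (inl) and one subdivision vertex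
   per edge of T (inr). *)
Definition SV := (T + tedge)%type.

Definition S_adj (u v : SV) : bool :=
  match u, v with
  | inl t, inr A => t \in val A
  | inr A, inl t => t \in val A
  | _, _ => false
  end.

Definition X_S : {set SV} := [set v | if v is inl _ then true else false].

(* edges of F = S(T), canonically oriented from the T-vertex t to the
   subdivision vertex of the T-edge A containing t *)
Definition fedge := {p : T * tedge | p.1 \in val p.2}.

(* Data of a family of double-odd replacements of the edges of F:
   for each edge f of F and each b : bool, the b-th x,y-path replacing f has
   length 2 * len f b + 1 (an arbitrary odd length).  If both lengths are 1
   the edge f is kept unchanged.  Internal vertices of path (f,b) are
   indexed by k < 2 * len f b (vertex k sits at distance k+1 from the
   T-vertex end); N is an upper bound for the index type. *)
Variables (N : nat) (len : fedge -> bool -> nat).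

Definition HV0 := (SV + (fedge * bool * 'I_N))%type.

Definition HV_valid (v : HV0) : bool :=
  match v with
  | inl _ => true
  | inr (f, b, k) => val k < 2 * len f b
  end.

Definition HV := {v : HV0 | HV_valid v}.

Definition H_raw (u v : HV0) : bool :=
  match u, v with
  | inl (inl t), inl (inr A) =>
      (* an original edge of F, present iff one of its two paths has length 1 *)
      [exists f : fedge, [&& (val f).1 == t, (val f).2 == A &
                             (len f false == 0) || (len f true == 0)]]
  | inl (inl t), inr (f, b, k) => ((val f).1 == t) && (val k == 0)
  | inr (f, b, k), inr (f', b', k') => [&& f == f', b == b' & val k' == (val k).+1]
  | inr (f, b, k), inl (inr A) => ((val f).2 == A) && ((val k).+1 == 2 * len f b)
  | _, _ => false
  end.

Definition H_adj (u v : HV) : bool := H_raw (val u) (val v) || H_raw (val v) (val u).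

Definition XF_in_H : {set HV} :=
  [set v | if val v is inl (inl _) then true else false].

End Cactus.

(* The bipartition class of a (connected, bipartite) graph containing a given
   set X0: the vertices joined to a vertex of X0 by a walk of even length. *)
Definition adj2 (V : finType) (adj : rel V) : rel V :=
  fun u w => [exists c, adj u c && adj c w].

Definition bip_class (V : finType) (adj : rel V) (X0 : {set V}) : {set V} :=
  [set v | [exists x in X0, connect (adj2 adj) x v]].

Definition XH (T : finType) (eT : rel T) (N : nat) (len : fedge eT -> bool -> nat)
  : {set HV N len} :=
  bip_class (@H_adj T eT N len) (XF_in_H N len).

Section MBD.
Variables (V : finType) (adj : rel V) (D : {set V}).

Definition staller_won (S : {set V}) : bool :=
  [exists v in ~: D, cnbhd adj v \subset S].

Fixpoint staller_wins_from (n : nat) (S Dm : {set V}) (st : bool) : bool :=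
  match n with
  | 0 => staller_won S
  | n'.+1 =>
      if st then [exists v in ~: (S :|: Dm), staller_wins_from n' (v |: S) Dm false]
      else [forall v in ~: (S :|: Dm), staller_wins_from n' S (v |: Dm) true]
  end.

(* The game: Staller starts, all #|V| vertices get claimed. *)
Definition staller_wins : bool := staller_wins_from #|V| set0 set0 true.

End MBD.

Definition dominator_wins (V : finType) (adj : rel V) (D : {set V}) : bool :=
  ~~ staller_wins adj D.

Definition MBD_critical (V : finType) (adj : rel V) (D : {set V}) : Prop :=
  staller_wins adj D /\ (forall v, v \notin D -> dominator_wins adj (v |: D)).

Definition atomic_MBD_critical (V : finType) (adj : rel V) (D : {set V}) : Prop :=
  [/\ MBD_critical adj D,
      (forall u v, u \in D -> v \in D -> ~~ adj u v) &
      (forall u, u \in D -> exists v, adj u v)].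

(* Main.v *)
Require Import Defs.
From mathcomp Require Import all_boot zify.

Set Implicit Arguments.
Unset Strict Implicit.
Unset Printing Implicit Defensive.

(** Root [T] at a vertex [t0].  Staller repeatedly claims the subdivision vertex
    of the edge joining a deepest remaining vertex [t] to its parent.  This
    splits off a "spider" (the vertex [t] with the paths hanging from it, all of
    even length), while the rest is again a cactus of the same kind.  Both parts
    are Staller wins and Dominator can answer in only one of them.

    If a vertex [v] of [X(H)] is moreover predominated, then [H - v] has a
    perfect matching, which gives Dominator a pairing strategy: root [T] at [v],
    or at the [T]-end of the path containing [v], and match every vertex of [T]
    along a path towards its parent (or towards [v]), shifting the matching of
    the inner vertices on that path. *)

(** * Strategies for both players on an arbitrary predominated graph *)

Section Game.
Variables (V : finType) (adj : rel V) (D : {set V}).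
Implicit Types (A B S U Dm : {set V}).

Lemma disjoint_setU1 x A B : [disjoint x |: A & B] = (x \notin B) && [disjoint A & B].
Proof. by rewrite -!setI_eq0 setIUl setU_eq0 !setI_eq0 disjoints1. Qed.

Lemma card_unclaimed_staller S Dm n u :
  u \in ~: (S :|: Dm) -> #|~: (S :|: Dm)| = n.+1 -> #|~: (u |: S :|: Dm)| = n.
Proof.
move=> uP; rewrite (cardsD1 u) uP add1n => -[<-].
by apply: eq_card => w; rewrite !inE -orbA negb_or.
Qed.

Lemma card_unclaimed_dominator S Dm n u :
  u \in ~: (S :|: Dm) -> #|~: (S :|: Dm)| = n.+1 -> #|~: (S :|: (u |: Dm))| = n.
Proof.
rewrite setUCA setUA => uP.
exact: card_unclaimed_staller.
Qed.

(** Staller's set only grows. The counter equals the number of unclaimed vertices, so she has a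
    legal move until it reaches 0. *)
Lemma staller_won_persists n S Dm st :
  #|~: (S :|: Dm)| = n -> staller_won adj D S ->
  staller_wins_from adj D n S Dm st.
Proof.
elim: n S Dm st => [//|n IH] S Dm st cardE won /=.
case: st; last first.
  apply/forall_inP => u uP; apply: IH => //.
  exact: card_unclaimed_dominator cardE.
have /card_gt0P[u uP] : 0 < #|~: (S :|: Dm)| by rewrite cardE.
apply/exists_inP; exists u => //; apply: IH.
  exact: card_unclaimed_staller cardE.
have /exists_inP[x xD xS] := won.
apply/exists_inP; exists x => //.
exact: subset_trans xS (subsetUr _ _).
Qed.

(* Staller, to move and owning [S], can win by playing inside the unclaimed
   region [U] only: either she completes a closed neighbourhood at once, or her
   move leaves two disjoint winning regions and Dominator can spoil only one. *)
Inductive forced_win : {set V} -> {set V} -> Prop :=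
| forced_close S U x :
    x \in U -> x \notin D -> cnbhd adj x \subset x |: S -> forced_win S U
| forced_fork S U U1 U2 y :
    y \in U -> y \notin U1 -> y \notin U2 -> U1 \subset U -> U2 \subset U ->
    [disjoint U1 & U2] -> forced_win (y |: S) U1 -> forced_win (y |: S) U2 ->
    forced_win S U.

Lemma forced_win_mono S U S' U' :
  S \subset S' -> U \subset U' -> forced_win S U -> forced_win S' U'.
Proof.
move=> sS sU w; elim: w S' U' sS sU 
  => {S U} [S U x xU xD xS|S U U1 U2 y yU y1 y2 s1 s2 d12 _ IH1 _ IH2] S' U' sS sU.
  apply: (forced_close (subsetP sU _ xU) xD).
  exact: subset_trans xS (setUS _ sS).
apply: (@forced_fork _ _ U1 U2 y) => //; first exact: subsetP sU _ yU.
- exact: subset_trans s1 sU.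
- exact: subset_trans s2 sU.
- by apply: IH1 => //; apply: setUS.
- by apply: IH2 => //; apply: setUS.
Qed.

Lemma forced_win_nonempty S U : forced_win S U -> exists u, u \in U.
Proof. by case=> [S' U' x xU *|S' U' U1 U2 y yU *]; [exists x|exists y]. Qed.

(** After a fork, Dominator's single reply misses [U1] or [U2]; the missed region is still
    unclaimed, so Staller goes on there by induction on the derivation. *)
Lemma forced_win_wins S U n Dm :
  forced_win S U -> [disjoint U & S :|: Dm] -> #|~: (S :|: Dm)| = n ->
  staller_wins_from adj D n S Dm true.
Proof.
move=> w; elim: w n Dm 
  => {S U} [S U x xU xD xS|S U U1 U2 y yU y1 y2 s1 s2 d12 w1 IH1 _ IH2] n Dm dU cardE.
  have xP : x \in ~: (S :|: Dm) by rewrite in_setC (disjointFr dU).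
  case: n cardE => [/eqP|n cardE]; first by rewrite cards_eq0 => /eqP E; rewrite E inE in xP.
  apply/exists_inP; exists x => //.
  apply: staller_won_persists; first exact: card_unclaimed_staller cardE.
  by apply/exists_inP; exists x; rewrite ?inE.
have yP : y \in ~: (S :|: Dm) by rewrite in_setC (disjointFr dU).
case: n cardE => [/eqP|n cardE]; first by rewrite cards_eq0 => /eqP E; rewrite E inE in yP.
apply/exists_inP; exists y => //.
have cardE' := card_unclaimed_staller yP cardE.
have free U' : U' \subset U -> y \notin U' -> [disjoint U' & y |: S :|: Dm].
  move=> sU' yU'; rewrite disjoint_sym -setUA disjoint_setU1 yU' /= disjoint_sym.
  exact: disjointWl sU' dU.
have dU1 := free _ s1 y1; have dU2 := free _ s2 y2.
(* The board is not yet full: [U1] holds an unclaimed vertex. *)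
case: n cardE' {cardE} => [/eqP|n cardE].
  rewrite cards_eq0 => /eqP E; have [u u1] := forced_win_nonempty w1.
  by have := disjointFr dU1 u1; move/setP/(_ u): E; rewrite inE in_set0 => /negbFE ->.
apply/forall_inP => v vP.
have cardE' := card_unclaimed_dominator vP cardE.
have free2 U' : [disjoint U' & y |: S :|: Dm] -> v \notin U' ->
    [disjoint U' & y |: S :|: (v |: Dm)].
  by move=> dU' vU'; rewrite setUCA disjoint_sym disjoint_setU1 vU' disjoint_sym.
have [v1|v1] := boolP (v \in U1); last by apply: IH1 => //; apply: free2.
by apply: IH2 => //; apply: free2; rewrite ?(disjointFr d12 v1).
Qed.

(* Staller plays the [y i] in decreasing order of rank, each move splitting off
   the region [W i]; what is left at the end is [Wf]. *)
Lemma forced_win_peel (I : finType) (J : {set I}) (rk : I -> nat) (y : I -> V)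
    (W : I -> {set V}) (Wf S U : {set V}) :
  {in J, forall i, y i \in U} -> {in J, forall i, W i \subset U} ->
  Wf \subset U -> {in J &, injective y} ->
  {in J &, forall i j, y i \notin W j} -> {in J, forall i, y i \notin Wf} ->
  {in J &, forall i j, i != j -> [disjoint W i & W j]} ->
  {in J, forall i, [disjoint W i & Wf]} ->
  (forall i S', i \in J -> S \subset S' -> y i \in S' ->
     {in J, forall j, rk i < rk j -> y j \in S'} -> forced_win S' (W i)) ->
  (forall S', S \subset S' -> {in J, forall j, y j \in S'} ->
     forced_win S' Wf) ->
  forced_win S U.
Proof.
move En : #|J| => n.
elim: n J S U En => [|n IH] J S U En yU WU fU yI yW yf dW df hW hf.
  move/eqP: En; rewrite cards_eq0 => /eqP E.
  apply: (forced_win_mono (subxx S) fU); apply: hf => // j.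
  by rewrite E inE.
have /card_gt0P[i0 i0J] : 0 < #|J| by rewrite En.
have [i /= iJ imax] : exists2 i, i \in J & {in J, forall j, rk j <= rk i}.
  by case: (arg_maxnP rk i0J) => i iJ imax; exists i.
have JD j : j \in J :\ i -> j \in J by case/setD1P.
(* One branch is [W i], the other is all the rest, which contains the remaining regions. Since [i]
   has maximal rank, no move of higher rank is required before [W i] is won. *)
apply: (@forced_fork _ _ (W i) (U :\: (y i |: W i)) (y i)).
- exact: yU.
- exact: yW.
- by rewrite !inE eqxx.
- exact: WU.
- exact: subsetDl.
- by rewrite disjoint_sym disjoints_subset; apply/subsetP => u; rewrite !inE negb_or => /andP[/andP[]].
- apply: hW => //; rewrite ?inE ?eqxx //; first exact: subsetUr.
  by move=> j /imax /= le; rewrite ltnNge le.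
have sub A : A \subset U -> y i \notin A -> [disjoint A & W i] ->
    A \subset U :\: (y i |: W i).
  move=> sA yA dA; apply/subsetP => u uA; rewrite !inE (subsetP sA) // andbT.
  by rewrite (disjointFr dA uA) orbF; apply: contraNneq yA => <-.
apply: (IH (J :\ i)).
- by move: En; rewrite (cardsD1 i) iJ => -[].
- move=> j jJ; rewrite !inE yU ?JD // andbT (negPf (yW _ _ (JD _ jJ) iJ)) orbF.
  by case/setD1P: jJ => ji jJ; apply: contra_neq ji => /yI; apply.
- move=> j /setD1P[ji jJ].
  by apply: sub; [apply: WU|apply: yW|apply: dW].
- by apply: sub => //; [apply: yf|rewrite disjoint_sym; apply: df].
- by move=> j k jJ kJ; apply: yI; apply: JD.
- by move=> j k jJ kJ; apply: yW; apply: JD.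
- by move=> j jJ; apply: yf; apply: JD.
- by move=> j k jJ kJ; apply: dW; apply: JD.
- by move=> j jJ; apply: df; apply: JD.
- move=> j S' jJ sS yS h; have [jJ' sS'] := (JD _ jJ, subset_trans (subsetUr _ _) sS).
  apply: hW => // k kJ jk; have [->|ki] := eqVneq k i.
    by apply: (subsetP sS); rewrite setU11.
  by apply: h => //; rewrite !inE ki.
move=> S' sS h; apply: hf; first exact: subset_trans (subsetUr _ _) sS.
move=> k kJ; have [->|ki] := eqVneq k i.
  by apply: (subsetP sS); rewrite setU11.
by apply: h => //; rewrite !inE ki.
Qed.

(* Dominator answers inside the pairs [{x, m x}]: at each of Staller's turns
   every pair is either untouched or already hit by Dominator. *)
Lemma pairing_dominator_wins (m : V -> V) :
  {in ~: D &, injective m} -> {in ~: D, forall x, m x \in D} ->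
  {in ~: D, forall x, adj x (m x)} -> dominator_wins adj D.
Proof.
move=> mI mD mA.
pose safe S Dm x := [|| x \in Dm, m x \in Dm | (x \notin S) && (m x \notin S)].
have neq_m x : x \in ~: D -> m x != x.
  by move=> xD; apply: contraTneq (mD x xD) => ->; rewrite -in_setC.
have notwon S Dm : [disjoint S & Dm] ->
    {in ~: D, forall x, (x \in Dm) || (m x \in Dm)} -> ~~ staller_won adj D S.
  move=> d hit; apply/exists_inP => -[x xD xS].
  have := hit x xD; rewrite !(disjointFr d) //; apply: (subsetP xS).
    by rewrite !inE mA ?orbT.
  by rewrite !inE eqxx.
suff main n S Dm : #|~: (S :|: Dm)| = n -> [disjoint S & Dm] ->
    {in ~: D, forall x, safe S Dm x} -> ~~ staller_wins_from adj D n S Dm true.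
  apply: main; first by rewrite setU0 setC0 cardsT.
    by rewrite -setI_eq0 set0I.
  by move=> x _; rewrite /safe !inE.
(* A round uses up two vertices, hence strong induction. *)
elim/ltn_ind: n S Dm => -[|n] IH S Dm cardE dS inv.
  apply: (notwon _ _ dS) => x xD; case/or3P: (inv x xD) => [->//|->|/andP[xS _]].
    by rewrite orbT.
  move/eqP: cardE; rewrite cards_eq0 => /eqP/setP/(_ x).
  by rewrite !inE (negPf xS) /= => /negbFE ->.
apply/exists_inP => -[u uP]; apply/negP.
have cardE' := card_unclaimed_staller uP cardE.
have dS' : [disjoint u |: S & Dm].
  by rewrite disjoint_setU1 dS andbT; move: uP; rewrite !inE negb_or => /andP[].
(* If Staller's move [u] hits an untouched pair [{x, m x}], Dominator replies with its other element
   [w]. *)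
have [/exists_inP[x xD /andP[xu /andP[xN mN]]]|noP] :=
    boolP [exists x in ~: D, ((x == u) || (m x == u)) &&
                              ((x \notin S :|: Dm) && (m x \notin S :|: Dm))].
  pose w := if x == u then m x else x.
  have wP : w \in ~: (u |: S :|: Dm).
    rewrite in_setC -setUA in_setU1 negb_or /w; case: ifP xu => [/eqP<- _|/negbT xu /= /eqP mu].
      by rewrite neq_m.
    by rewrite xu.
  case: n IH cardE cardE' => [|n] IH cardE cardE'.
    by move/eqP: cardE'; rewrite cards_eq0 => /eqP E; rewrite E inE in wP.
  apply/forall_inPn; exists w => //; apply: IH => //.
  - exact: card_unclaimed_dominator cardE'.
  - by rewrite disjoint_sym disjoint_setU1 disjoint_sym dS' andbT; move: wP; rewrite !inE negb_or => /andP[].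
  move=> z zD; have [->|zx] := eqVneq z x.
    by rewrite /safe !inE /w; case: ifP; rewrite eqxx ?orbT.
  case/or3P: (inv z zD) => [zm|zm|/andP[zS mzS]].
  - by rewrite /safe !inE zm orbT.
  - by rewrite /safe !inE zm !orbT.
  rewrite /safe; apply/or3P; apply: Or33; rewrite !inE !negb_or zS mzS !andbT.
  (* Distinct pairs are disjoint: [m] is injective and maps [~: D] into [D], so [u] lies in no other
     pair. *)
  have zNm t : t \in ~: D -> z != m t.
    by move=> tD; apply: contraTneq zD => ->; rewrite inE negbK mD.
  case/orP: xu => /eqP <-; rewrite ?zx ?zNm ?andbT //=.
    by rewrite eq_sym; apply: contraTneq xD => ->; rewrite inE negbK mD.
  by apply: contra_neq zx => /mI ->.
(* Here [u] hits no untouched pair, so the invariant survives and any reply will do. *)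
have inv' : {in ~: D, forall x, safe (u |: S) Dm x}.
  move=> x xD; move/exists_inPn: noP => /(_ x xD).
  move: (inv x xD); rewrite /safe !inE.
  case: (x \in Dm); case: (m x \in Dm); rewrite ?orbT //= !orbF => /andP[/negPf-> /negPf->].
  by rewrite andbT !orbF negb_or.
case: n IH cardE cardE' => [|n] IH cardE cardE'.
  apply: (notwon _ _ dS') => x xD; case/or3P: (inv' x xD) => [->//|->|/andP[xS _]].
    by rewrite orbT.
  move/eqP: cardE'; rewrite cards_eq0 => /eqP/setP/(_ x).
  by rewrite in_setC in_setU (negPf xS) in_set0 /= => /negbFE ->.
have /card_gt0P[w wP] : 0 < #|~: (u |: S :|: Dm)| by rewrite cardE'.
apply/forall_inPn; exists w => //; apply: IH => //.
- exact: card_unclaimed_dominator cardE'.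
- by rewrite disjoint_sym disjoint_setU1 disjoint_sym dS' andbT; move: wP; rewrite !inE negb_or => /andP[].
move=> z zD; case/or3P: (inv' z zD) => [zm|zm|zm].
- by rewrite /safe !inE zm orbT.
- by rewrite /safe !inE zm !orbT.
- by rewrite /safe zm !orbT.
Qed.
End Game.

(** * Rooting a tree *)

Definition is_rooting (T : finType) (eT : rel T) (t0 : T) (p : T -> T)
    (rk : T -> nat) : Prop :=
  [/\ forall t, t != t0 -> eT t (p t), forall t, t != t0 -> rk (p t) < rk t &
      forall x y, eT x y -> (x != t0) && (p x == y) || (y != t0) && (p y == x)].

Section Tree.
Variables (T : finType) (eT : rel T).
Hypothesis treeT : is_tree eT.

(** A simple path from [x] to [y] avoiding the edge has length at least 2, so the edge closes it
    into a forbidden cycle. *)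
Lemma tree_edge_bridge x y : eT x y ->
  ~~ connect (fun u v => eT u v && ([set u; v] != [set x; y])) x y.
Proof.
case: treeT => -[symT irrT] _ _ acyc exy.
apply/negP => /connectP[q qP yE]; case: (shortenP qP) yE => q' q'P uq _ yE {q qP}.
have sub u v : eT u v && ([set u; v] != [set x; y]) -> eT u v by case/andP.
have := acyc x q'; rewrite uq /= rcons_path (sub_path sub q'P) -yE symT exy /=.
case: q' q'P yE {uq} => [_ yE|a [|b q'']] /=.
- by rewrite yE irrT in exy.
- by move=> q'P yE; rewrite -yE eqxx andbF in q'P.
- by move=> _ _ /(_ isT isT).
Qed.

(** The rank is the distance to [t0], and the parent is the last vertex but one of a shortest walk
    from [t0]. *)
Lemma tree_rooting t0 : exists p rk, is_rooting eT t0 p rk.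
Proof.
case: (treeT) => -[symT irrT] _ conT _.
pose at_dist n t := [exists q : n.-tuple T, path eT t0 q && (last t0 q == t)].
have exd t : exists n, at_dist n t.
  have /connectP[q qP ->] := conT t0 t; exists (size q).
  by apply/existsP; exists (in_tuple q); rewrite /= qP eqxx.
pose rk t := ex_minn (exd t).
(* The implication gives [t0] a dummy witness, so that the parent function is total. *)
have exp t : exists u, (t != t0) ==> eT t u && (rk u < rk t).
  have [->|tt0] := eqVneq t t0; first by exists t0.
  rewrite /rk; case: ex_minnP => n /existsP[q /andP[qP /eqP lq]] _.
  case/lastP E: {1}(tval q) qP lq => [|q' a].
    by rewrite E => _ /= lq; rewrite -lq eqxx in tt0.
  rewrite E rcons_path last_rcons => /andP[q'P ea] <-.
  exists (last t0 q'); rewrite symT ea /=; case: ex_minnP => k _ kmin.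
  have -> : n = (size q').+1 by rewrite -(size_tuple q) E size_rcons.
  by apply: kmin; apply/existsP; exists (in_tuple q'); rewrite /= q'P eqxx.
have [p pP] : exists p, forall t, t != t0 -> eT t (p t) && (rk (p t) < rk t).
  by exists (fun t => xchoose (exp t)) => t; apply/implyP/(xchooseP (exp t)).
exists p, rk.
split=> [t /pP/andP[]//|t /pP/andP[]//|x y exy].
apply: contraT; rewrite negb_or => /andP[nx ny].
(* If [xy] were no parent edge, climbing to the root would never use it, and [x] and [y] would stay
   connected without it. *)
pose e' u v := eT u v && ([set u; v] != [set x; y]).
have syme' : symmetric e' by move=> u v; rewrite /e' symT setUC.
have to_root n t : rk t < n -> connect e' t t0.
  elim: n t => // n IH t lt; have [->|tt0] := eqVneq t t0; first exact: connect0.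
  have /andP[et lt'] := pP t tt0.
  apply: connect_trans (connect1 _) (IH _ (leq_trans lt' lt)).
  rewrite /e' et; apply/negP => /eqP E.
  have : t \in [set x; y] by rewrite -E !inE eqxx.
  have : p t \in [set x; y] by rewrite -E !inE eqxx orbT.
  have tneq : p t != t by apply: contraTneq et => ->; rewrite irrT.
  rewrite !inE => /orP[] /eqP E1 /orP[] /eqP E2; subst t; move: tneq tt0; rewrite ?E1 ?eqxx //.
    by move=> _ yt0; rewrite yt0 E1 eqxx in ny.
  by move=> _ xt0; rewrite xt0 E1 eqxx in nx.
have := tree_edge_bridge exy; rewrite -/e' => /negP[].
apply: connect_trans (to_root _ _ (ltnSn _)) _.
by rewrite (sym_connect_sym syme'); apply: to_root (ltnSn _).
Qed.

End Tree.

(** * Coordinates on the cactus and its bipartition *)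

Section CactusVertices.
Variables (T : finType) (eT : rel T) (N : nat) (len : fedge eT -> bool -> nat).
Hypothesis lenN : forall f b, 2 * len f b <= N.

Local Notation HV := (HV N len).
Local Notation adj := (@H_adj T eT N len).
(* [(f, b) : channel] names the [b]-th path replacing the edge [f] of [S(T)]. *)
Local Notation channel := (fedge eT * bool)%type.

Definition top (c : channel) : T := (val c.1).1.
Definition bot (c : channel) : tedge eT := (val c.1).2.
Definition inner (c : channel) : nat := 2 * len c.1 c.2.

Definition tv (t : T) : HV := exist _ (inl (inl t)) isT.
Definition sv (A : tedge eT) : HV := exist _ (inl (inr A)) isT.

(* For [k >= inner c] this is the end [sv (bot c)] of the path, so that
   [tv (top c), pv c 0, ..., pv c (inner c)] is the whole path. *)
Definition pv (c : channel) (k : nat) : HV :=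
  if insub k is Some j then insubd (sv (bot c)) (inr (c, j) : HV0 eT N)
  else sv (bot c).

Lemma val_pv c k : k < inner c ->
  exists2 j : 'I_N, val j = k & val (pv c k) = inr (c, j).
Proof.
case: c => f b lt; have ltN : k < N := leq_trans lt (lenN f b).
exists (Ordinal ltN) => //; rewrite /pv insubT.
by rewrite val_insubd /= lt.
Qed.

Lemma pv_end c k : inner c <= k -> pv c k = sv (bot c).
Proof.
case: c => f b le; rewrite /pv; case: insubP => [j _ jk|//].
by rewrite /insubd insubF //= jk ltnNge [_ <= k]le.
Qed.

Lemma pv_ord c (k : 'I_N) (x : HV) :
  val x = inr (c, k) -> k < inner c /\ x = pv c k.
Proof.
case: x => x xP /= xE; subst x; case: c xP => f b lt.
split=> //; apply: val_inj => /=; have [j jk ->] := @val_pv (f, b) k lt.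
by congr (inr (_, _)); apply: val_inj.
Qed.

Variant vertex_spec : HV -> Type :=
| VertexT t : vertex_spec (tv t)
| VertexS A : vertex_spec (sv A)
| VertexP c k of k < inner c : vertex_spec (pv c k).

Lemma vertexP x : vertex_spec x.
Proof.
case E: (val x) => [[t|A]|[c k]].
- have -> : x = tv t by apply: val_inj.
  exact: VertexT.
- have -> : x = sv A by apply: val_inj.
  exact: VertexS.
- by have [lt ->] := pv_ord E; apply: VertexP.
Qed.

Lemma pv_inj c k c' k' : k < inner c -> pv c k = pv c' k' ->
  c = c' /\ k = k'.
Proof.
move=> lt E; have [lt'|le] := ltnP k' (inner c').
  have [j jk jE] := val_pv lt; have [j' jk' jE'] := val_pv lt'.
  by move: (congr1 val E); rewrite jE jE' -jk -jk' => -[-> ->].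
by have [j _] := val_pv lt; rewrite E pv_end.
Qed.

Lemma sv_inj : injective sv.
Proof. by move=> A B /(congr1 val) []. Qed.

Lemma pv_neq_tv c k t : pv c k <> tv t.
Proof.
have [lt|le] := ltnP k (inner c); last by rewrite pv_end // => /(congr1 val).
by have [j _ E] := val_pv lt; move=> /(congr1 val); rewrite E.
Qed.

Lemma adj_sym : symmetric adj.
Proof. by move=> x y; rewrite /H_adj orbC. Qed.

Lemma adj_tv_pv c : adj (tv (top c)) (pv c 0).
Proof.
rewrite /H_adj; have [lt|le] := ltnP 0 (inner c).
  by have [j j0 ->] := val_pv lt; case: c j0 {lt} => f b j0 /=; rewrite eqxx j0.
rewrite pv_end //=; apply/orP; left; apply/existsP; exists c.1; rewrite !eqxx /=.
by move: le; rewrite leqn0 muln_eq0 /=; case: c.2 => /= ->; rewrite ?orbT.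
Qed.

Lemma adj_pvS c k : k < inner c -> adj (pv c k) (pv c k.+1).
Proof.
move=> lt; rewrite /H_adj; have [j jk ->] := val_pv lt.
have [lt'|le] := ltnP k.+1 (inner c).
  by have [j' jk' ->] := val_pv lt'; case: c {lt lt'} => f b /=; rewrite jk jk' !eqxx.
have kE : k.+1 = inner c by apply/eqP; rewrite eqn_leq lt le.
rewrite pv_end //=; case: c lt le kE => f b lt le kE /=; rewrite jk.
by rewrite eqxx; apply/orP; left; apply/eqP.
Qed.

Lemma adj_tv t x : adj (tv t) x -> exists2 c, top c = t & x = pv c 0.
Proof.
rewrite /H_adj; case E: (val x) => [[s|A]|[[f b] k]] /=.
- by [].
- rewrite orbF => /existsP[f /and3P[/eqP ft /eqP fA lf]].
  have xA : x = sv A by apply: val_inj.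
  have [b lb] : exists b, len f b = 0.
    by case/orP: lf => /eqP; [exists false|exists true].
  by exists (f, b) => //; rewrite xA pv_end /inner ?lb //= /bot fA.
- rewrite orbF => /andP[/eqP ft /eqP k0].
  by have [_ ->] := pv_ord E; exists (f, b); rewrite ?k0.
Qed.

(** Odd [k] excludes position 0, whose predecessor on the path is [tv (top c)] and not
    [pv c 0.-1]. *)
Lemma adj_pv_odd c k x : odd k -> k < inner c -> adj (pv c k) x ->
  x = pv c k.-1 \/ x = pv c k.+1.
Proof.
move=> ok lt; rewrite /H_adj; have [j jk ->] := val_pv lt; case: c lt => f b lt.
case E: (val x) => [[s|A]|[[f' b'] k']] /=.
- by rewrite jk => /andP[_ /eqP k0]; rewrite k0 in ok.
- rewrite orbF jk => /andP[/eqP fA /eqP kl]; right.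
  by rewrite pv_end ?kl // /bot /= fA; apply: val_inj.
have [_ ->] := pv_ord E; rewrite jk.
case/orP=> /and3P[/eqP-> /eqP-> /eqP->]; [by right|by left].
Qed.

(** Explicit form of [XH]: position [k] is at distance [k + 1] from the [T]-end of its path, so odd
    positions are at even distance. *)
Definition in_class (x : HV) : bool :=
  match val x with
  | inl (inl _) => true
  | inl (inr _) => false
  | inr (_, k) => odd k
  end.

Lemma in_class_pv c k : k <= inner c -> in_class (pv c k) = odd k.
Proof.
rewrite leq_eqVlt => /orP[/eqP ->|lt]; last first.
  by rewrite /in_class; have [j jk ->] := val_pv lt; rewrite jk.
by rewrite pv_end // /in_class /= /inner oddM.
Qed.

Lemma in_class_adj x y : adj x y -> in_class y = ~~ in_class x.
Proof.
suff raw u v : H_raw len (val u) (val v) -> in_class v = ~~ in_class u.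
  by case/orP => /raw // ->; rewrite negbK.
rewrite /in_class; case: (val u) => [[t|A]|[[f b] k]];
  case: (val v) => [[t'|A']|[[f' b'] k']] //=.
- by case/andP=> _ /eqP ->.
- by case/andP=> _ /eqP /(congr1 odd); rewrite oddM /= => /negbFE ->.
- by case/and3P=> _ _ /eqP ->.
Qed.

Lemma in_XH x : (x \in XH N len) = in_class x.
Proof.
rewrite inE; apply/exists_inP/idP => [[y yX /connectP[p pP ->]]|].
  have : in_class y by move: yX; rewrite inE /in_class; case: (val y) => [[]|].
  elim: p y pP {yX} => //= z p IH y /andP[/existsP[c /andP[yc cz]] pP] cy.
  by apply: IH pP _; rewrite (in_class_adj cz) (in_class_adj yc) negbK.
case: (vertexP x) => [t|A|c k lt] //.
  by move=> _; exists (tv t); rewrite ?inE //; apply: connect0.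
rewrite in_class_pv 1?ltnW // => ok; exists (tv (top c)); first by rewrite inE.
elim/ltn_ind: k lt ok => -[|[|k]] // IH lt ok.
  by apply/connect1/existsP; exists (pv c 0); rewrite adj_tv_pv adj_pvS // ltnW.
apply: connect_trans (IH k _ _ _) (connect1 _) => //; first by lia.
  by move: ok; rewrite /= negbK.
by apply/existsP; exists (pv c k.+1); rewrite !adj_pvS //; lia.
Qed.

Lemma class_compl_not_isolated x : ~~ in_class x -> exists y, adj x y.
Proof.
case: (vertexP x) => [t|A|c k lt] //= ic; last by exists (pv c k.+1); apply: adj_pvS.
have /existsP[t /existsP[s /andP[_ /eqP AE]]] := valP A.
have tA : t \in val A by rewrite AE !inE eqxx.
pose c : channel := (exist _ (t, A) tA, false).
case E: (inner c) => [|k].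
  exists (tv t); rewrite adj_sym; have -> : sv A = pv c 0 by rewrite pv_end ?E.
  exact: (adj_tv_pv c).
exists (pv c k); have -> : sv A = pv c k.+1 by rewrite pv_end ?E.
by rewrite adj_sym adj_pvS ?E.
Qed.

(** * Staller's win: cutting the cactus into spiders *)

Definition spider (t : T) : {set HV} :=
  [set x : HV | match val x with
           | inl (inl s) => s == t
           | inl (inr _) => false
           | inr (c, _) => top c == t
           end].

Lemma tv_spider t s : (tv t \in spider s) = (t == s).
Proof. by rewrite inE. Qed.

Lemma sv_spider A t : sv A \in spider t = false.
Proof. by rewrite inE. Qed.

Lemma pv_spider c k t : k < inner c -> (pv c k \in spider t) = (top c == t).
Proof. by move=> lt; rewrite inE; have [j _ ->] := val_pv lt. Qed.

Lemma spider_disjoint t s : t != s -> [disjoint spider t & spider s].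
Proof.
move=> ts; rewrite -setI_eq0; apply/eqP/setP => x; rewrite in_setI in_set0.
apply/negbTE/andP; case: (vertexP x) => [u|A|c k lt].
- by rewrite !tv_spider => -[/eqP ut /eqP us]; rewrite -ut -us eqxx in ts.
- by rewrite sv_spider => -[].
- by rewrite !pv_spider // => -[/eqP ut /eqP us]; rewrite -ut -us eqxx in ts.
Qed.

Local Notation win := (forced_win adj (~: XH N len)).

(* Once all neighbours [sv A] of [t] are Staller's, the legs of the spider are
   cut off two vertices at a time, starting from the tips. *)
Lemma spider_win t (S : {set HV}) :
  (forall c, top c = t -> sv (bot c) \in S) -> win S (spider t).
Proof.
move=> hS.
have notD x : (x \notin ~: XH N len) = in_class x by rewrite inE negbK in_XH.
(* Staller plays the even positions, each move splitting off the next odd position as a singleton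
   region. Ranking by position starts at the tips; the centre [tv t] remains for the end. *)
pose J := [set i : channel * 'I_N | [&& top i.1 == t, ~~ odd i.2 & i.2 < inner i.1]].
have JP c (k : 'I_N) : (c, k) \in J ->
    [/\ top c = t, ~~ odd k, k < inner c & k.+1 < inner c].
  rewrite inE /= => /and3P[/eqP ct ok lt]; split=> //.
  by move: lt; rewrite /inner; move: ok; move: (len _ _) => l; lia.
apply: (@forced_win_peel _ _ _ _ J (fun i => val i.2) (fun i => pv i.1 i.2)
          (fun i => [set pv i.1 i.2.+1]) [set tv t]).
- by case=> c k /JP[ct _ lt _]; rewrite pv_spider ?ct.
- by case=> c k /JP[ct _ _ lt]; rewrite sub1set pv_spider ?ct.
- by rewrite sub1set tv_spider.
- by case=> c k [c' k'] /JP[_ _ lt _] _ /= /(pv_inj lt)[-> /val_inj ->].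
- case=> c k [c' k'] /JP[_ ok lt _] /JP[_ ok' _ _]; rewrite inE /=.
  by apply/eqP => /(pv_inj lt)[_ E]; rewrite E /= ok' in ok.
- by case=> c k _; rewrite inE; apply/eqP/pv_neq_tv.
- case=> c k [c' k'] /JP[_ _ _ lt] _ /=; rewrite disjoints1 inE.
  by apply: contra_neqN => /eqP/(pv_inj lt)[-> [/val_inj ->]].
- by case=> c k _; rewrite disjoints1 inE; apply/eqP/pv_neq_tv.
- case=> c k S' /[dup] ckJ /JP[ct ok _ lt] sS yS hJ /=.
  apply: (@forced_close _ _ _ _ _ (pv c k.+1)).
  + by rewrite inE.
  + by rewrite notD in_class_pv 1?ltnW.
  apply/subsetP => x; rewrite !inE => /orP[-> //|/adj_pv_odd[]//-> /=].
    by rewrite yS orbT.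
  (* The outer neighbour is either an even position played earlier or the tip [sv (bot c)],
     Staller's by [hS]. *)
  apply/orP; right; have [lt2|le] := ltnP k.+2 (inner c); last first.
    by rewrite pv_end // (subsetP sS) // hS.
  have kN : k.+2 < N by apply: leq_trans lt2 (lenN _ _).
  by apply: (hJ (c, Ordinal kN)) => //=; rewrite inE /= ct eqxx negbK ok.
move=> S' sS hJ; apply: (@forced_close _ _ _ _ _ (tv t)).
- by rewrite inE.
- by rewrite notD.
apply/subsetP => x; rewrite !inE => /orP[-> //|/adj_tv[c ct ->]].
apply/orP; right; have [lt|le] := ltnP 0 (inner c); last first.
  by rewrite pv_end // (subsetP sS) // hS.
have kN : 0 < N by apply: leq_trans lt (lenN _ _).
by apply: (hJ (c, Ordinal kN)) => //=; rewrite inE /= ct eqxx.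
Qed.

(* [up] selects, for each edge of the rooted tree [T], the half joining its
   subdivision vertex to the endpoint farther from the root. *)
Lemma cactus_rooting t0 : is_tree eT ->
  exists (up : pred (fedge eT)) (rk : T -> nat),
  [/\ forall f, up f -> (val f).1 != t0,
      forall t, t != t0 -> exists2 f, up f & (val f).1 = t,
      {in up &, injective (fun f => (val f).1)},
      {in up &, injective (fun f => (val f).2)} &
      forall f, up f \/
        exists g, [/\ up g, (val g).2 = (val f).2 & rk (val f).1 < rk (val g).1]].
Proof.
move=> treeT; have [p [rk [ep ltp edgeP]]] := tree_rooting treeT t0.
have [[symT irrT] _ _ _] := treeT.
pose up (f : fedge eT) :=
  ((val f).1 != t0) && (val (val f).2 == [set (val f).1; p (val f).1]).
have exup t : t != t0 ->
    exists2 f, up f & (val f).1 = t /\ val (val f).2 = [set t; p t].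
  move=> tt0.
  have AP : is_tedge eT [set t; p t].
    by apply/existsP; exists t; apply/existsP; exists (p t); rewrite ep ?eqxx.
  pose A : tedge eT := Sub [set t; p t] AP.
  have tA : (t, A).1 \in val (t, A).2 by rewrite /= !inE eqxx.
  by exists (Sub (t, A) tA); rewrite // /up /= tt0 eqxx.
have fext (f g : fedge eT) : (val f).1 = (val g).1 -> (val f).2 = (val g).2 -> f = g.
  by move=> E1 E2; apply: val_inj; case: (val f) (val g) E1 E2 => [? ?] [? ?] /= -> ->.
exists up, rk; split.
- by move=> f /andP[].
- by move=> t /exup[f uf [ft _]]; exists f.
- move=> f g /andP[_ /eqP uf] /andP[_ /eqP ug] E; apply: fext => //.
  by apply: val_inj; rewrite /= uf ug E.
- move=> f g /andP[f0 /eqP uf] /andP[g0 /eqP ug] E; apply: fext => //.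
  have fg : [set (val f).1; p (val f).1] = [set (val g).1; p (val g).1].
    by rewrite -uf -ug E.
  have := ltp _ f0; have := ltp _ g0; move: fg.
  move: (val f).1 (val g).1 => s t fg ltt lts.
  (* If [s] and [t] differed, each would be the parent of the other, against the ranks. *)
  have : s \in [set t; p t] by rewrite -fg !inE eqxx.
  have : t \in [set s; p s] by rewrite fg !inE eqxx.
  rewrite !inE => /orP[/eqP-> //|/eqP tE] /orP[/eqP-> //|/eqP sE].
  by rewrite -tE in lts; rewrite -sE in ltt; lia.
move=> f; have := valP f; have /existsP[x /existsP[y /andP[exy /eqP AE]]] := valP (val f).2.
(* Let [x] be the child. The half at [x] is selected by [up]; the half at [y] is the second
   alternative, with the half at [x] as [g]. *)
wlog yx : x y exy AE / (x != t0) && (p x == y).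
  move=> H; case/orP: (edgeP _ _ exy) => [?|?]; first exact: (H x y).
  by apply: (H y x); rewrite 1?symT 1?setUC.
case/andP: yx => x0 /eqP pxy; have [g ug [gx gA]] := exup x x0.
have gfA : (val g).2 = (val f).2 by apply: val_inj; rewrite gA AE pxy.
rewrite AE !inE => /orP[] /eqP fE.
  by left; rewrite /up fE x0 AE pxy eqxx.
by right; exists g; split=> //; rewrite gx fE -pxy ltp.
Qed.

Lemma cactus_staller_wins : is_tree eT -> staller_wins adj (~: XH N len).
Proof.
move=> treeT; have [_ /card_gt0P[t0 _] _ _] := treeT.
have [up [rk [up0 _ upI1 upI2 upP]]] := cactus_rooting t0 treeT.
apply: (@forced_win_wins _ _ _ _ [set: HV]); last by rewrite setU0 setC0 cardsT.
  apply: (@forced_win_peel _ _ _ _ [set f | up f] (fun f => rk (val f).1)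
    (fun f => sv (val f).2) (fun f => spider (val f).1) (spider t0)).
  - by move=> f _; rewrite in_setT.
  - by move=> f _; apply: subsetT.
  - exact: subsetT.
  - by move=> f g; rewrite !inE => uf ug /sv_inj; apply: upI2.
  - by move=> f g _ _; rewrite sv_spider.
  - by move=> f _; rewrite sv_spider.
  - move=> f g; rewrite !inE => uf ug fg; apply: spider_disjoint.
    by apply: contra_neq fg; apply: upI1.
  - by move=> f; rewrite inE => uf; apply: spider_disjoint; apply: up0.
  (* A leg at [t] ends on the parent edge of [t], just claimed, or on the edge to a child, claimed
     earlier because its rank is larger. *)
  - move=> f S'; rewrite inE => uf _ fS hS; apply: spider_win => -[g b] /= gf.
    case: (upP g) => [ug|[h [uh hg lt]]]; first by rewrite -(upI1 f g).
    by rewrite /bot /= -hg hS ?inE // -gf.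
  move=> S' _ hS; apply: spider_win => -[g b] /= _; rewrite /bot /=.
  by case: (upP g) => [ug|[h [uh <- _]]]; apply: hS; rewrite inE.
by rewrite setU0 disjoint_sym -setI_eq0 set0I.
Qed.

(** * Dominator's matching when [v] is predominated *)

Section Matching.
(** Active paths carry the shifted matching. The shift runs up to position [thr c], which is either
    the end [sv (bot c)] or the vertex [v] itself. *)
Variables (act : pred channel) (thr : channel -> nat) (v : HV).
Hypothesis act_bot : forall c c', act c -> act c' ->
  thr c = inner c -> thr c' = inner c' -> bot c = bot c' -> c = c'.
Hypothesis act_thr : forall c, act c ->
  thr c = inner c \/ [/\ odd (thr c), thr c < inner c & v = pv c (thr c)].
Hypothesis act_ex : forall t, tv t <> v -> exists2 c, act c & top c = t.

(* Along an active path, [top c] and the odd vertices before [thr c] are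
   matched away from [top c]; all other odd vertices are matched towards it. *)
Definition cmatch (x : HV) : HV :=
  match val x with
  | inl (inl t) => if [pick c | act c && (top c == t)] is Some c then pv c 0 else x
  | inl (inr _) => x
  | inr (c, k) => if act c && (k < thr c) then pv c k.+1 else pv c k.-1
  end.

Variant cmatch_spec (x : HV) : HV -> Prop :=
| CmatchT c of act c & x = tv (top c) : cmatch_spec x (pv c 0)
| CmatchUp c k of odd k & k < inner c & act c & k < thr c & x = pv c k :
    cmatch_spec x (pv c k.+1)
| CmatchDown c k of odd k & k < inner c & act c ==> (thr c <= k) & x = pv c k :
    cmatch_spec x (pv c k.-1).

Lemma cmatchP x : in_class x -> x <> v -> cmatch_spec x (cmatch x).
Proof.
case: (vertexP x) => [t|A|c k lt] //.
  move=> _ tv'; rewrite /cmatch /=; case: pickP => [c /andP[ac /eqP ct]|no].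
    by apply: CmatchT; rewrite ?ct.
  by have [c ac ct] := act_ex tv'; have := no c; rewrite ac ct eqxx.
rewrite in_class_pv 1?ltnW // => ok _; rewrite /cmatch.
have [j jk ->] := val_pv lt; rewrite jk.
case: ifP => [/andP[ac kt]|/negbT]; first exact: CmatchUp.
by rewrite negb_and -implybE -leqNgt => kt; apply: CmatchDown.
Qed.

Lemma cmatch_adj x : in_class x -> x <> v -> adj x (cmatch x).
Proof.
move=> ix xv; case: (cmatchP ix xv) => [c _ ->|c k _ lt _ _ ->|c [|k] // _ lt _ ->].
- exact: adj_tv_pv.
- exact: adj_pvS.
- by rewrite adj_sym adj_pvS // ltnW.
Qed.

(** The coordinates of a partner are unique except at an end [sv A], reached only along an active
    path, where [act_bot] decides. Two matching rules can meet at a position only around [thr c],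
    where parity forces one of the matched vertices to be [v]. *)
Lemma cmatch_inj x y : in_class x -> x <> v -> in_class y -> y <> v ->
  cmatch x = cmatch y -> x = y.
Proof.
move=> ix xv iy yv.
suff code z : in_class z -> z <> v -> exists c j, [/\ cmatch z = pv c j, j <= inner c,
    j = inner c -> act c /\ thr c = inner c &
    [\/ [/\ act c, j = 0 & z = tv (top c)],
        [/\ odd j.-1, 0 < j, act c, j <= thr c & z = pv c j.-1] |
        [/\ odd j.+1, j.+1 < inner c, act c ==> (thr c <= j.+1) & z = pv c j.+1]]].
  have [c [j [-> jc je xE]]] := code x ix xv.
  have [c' [j' [-> jc' je' yE]]] := code y iy yv => E.
  have [cc jj] : c = c' /\ j = j'.
    have [lt|le] := ltnP j (inner c); first exact: pv_inj lt E.
    have [lt'|le'] := ltnP j' (inner c'); first by have [-> ->] := pv_inj lt' (esym E).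
    have {}jc : j = inner c by lia.
    have {}jc' : j' = inner c' by lia.
    have [[ac tc] [ac' tc']] := (je jc, je' jc').
    have cc : c = c'.
      by apply: act_bot => //; apply: sv_inj; rewrite -(pv_end le) -(pv_end le') E.
    by rewrite jc jc' cc.
  subst c' j'.
  have thr_neq k : act c -> pv c k <> v -> thr c = inner c \/ odd (thr c) /\ thr c <> k.
    move=> ac kv; case: (act_thr ac) => [|[o _ E']]; first by left.
    by right; split=> // tk; case: kv; rewrite -tk -E'.
  case: xE => [[ac j0 xE]|[oj j0 ac jt xE]|[oj jl jt xE]];
  case: yE => [[ac' j0' yE]|[oj' j0' ac' jt' yE]|[oj' jl' jt' yE]];
    rewrite xE yE //; exfalso.
  - by rewrite j0 in j0'.
  - by rewrite ac in jt'; rewrite yE in yv; case: (thr_neq _ ac yv) => *; lia.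
  - by rewrite j0' in j0.
  - by rewrite ac in jt'; rewrite yE in yv; case: (thr_neq _ ac yv) => *; lia.
  - by rewrite ac' in jt; rewrite xE in xv; case: (thr_neq _ ac' xv) => *; lia.
  - by rewrite ac' in jt; rewrite xE in xv; case: (thr_neq _ ac' xv) => *; lia.
move=> iz zv; case: (cmatchP iz zv) => [c ac zE|c k ok lt ac kt zE|c [|k] // ok lt kt zE].
- exists c, 0; split=> //; last exact: Or31.
  by move=> c0; split=> //; case: (act_thr ac) => // -[_]; rewrite -c0.
- exists c, k.+1; split=> //; last exact: Or32.
  by move=> kE; split=> //; case: (act_thr ac) => // -[_]; lia.
- by exists c, k; split=> //=; [lia|lia|apply: Or33].
Qed.

End Matching.

Lemma matching_exists v : is_tree eT -> in_class v ->
  exists m : HV -> HV,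
  (forall x, in_class x -> x <> v -> adj x (m x)) /\
  (forall x y, in_class x -> x <> v -> in_class y -> y <> v -> m x = m y -> x = y).
Proof.
move=> treeT; case: (vertexP v) => [t0|A|c0 k0 lt0] // iv.
  have [up [rk [up0 upE upI1 upI2 upP]]] := cactus_rooting t0 treeT.
  (* Either of the two parallel paths would serve; the one tagged [false] is taken. *)
  pose act (c : channel) := up c.1 && ~~ c.2.
  have actE t : tv t <> tv t0 -> exists2 c, act c & top c = t.
    move=> tt0; have [|f uf ft] := upE t; first by apply/eqP => E; rewrite E in tt0.
    by exists (f, false); rewrite // /act uf.
  exists (cmatch act inner); split; first exact: cmatch_adj.
  apply: cmatch_inj => //; last by left.
  move=> [f b] [g b'] /andP[/= uf /negPf/= ->] /andP[/= ug /negPf/= ->] _ _.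
  by move/(upI2 _ _ uf ug) ->.
rewrite in_class_pv 1?ltnW // in iv.
have [up [rk [up0 upE upI1 upI2 upP]]] := cactus_rooting (top c0) treeT.
(* The root [top c0] has no half selected by [up], so [c0] becomes its active path, with the shift
   stopped at [v]. *)
pose act (c : channel) := up c.1 && ~~ c.2 || (c == c0).
pose thr (c : channel) := if c == c0 then k0 else inner c.
have actE t : tv t <> pv c0 k0 -> exists2 c, act c & top c = t.
  move=> _; have [->|tt0] := eqVneq t (top c0).
    by exists c0; rewrite // /act eqxx orbT.
  by have [f uf ft] := upE t tt0; exists (f, false); rewrite // /act uf.
exists (cmatch act thr); split; first exact: cmatch_adj.
apply: cmatch_inj => //.
- move=> c c' ac ac'; rewrite /thr.
  (* As [k0 < inner c0], the path [c0] never competes for its end. *)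
  case: eqP => [-> kE|cn _]; first by rewrite kE ltnn in lt0.
  case: eqP => [-> kE|cn' _]; first by rewrite kE ltnn in lt0.
  case: c c' ac ac' cn cn' => [f b] [g b'].
  move=> /orP[|/eqP//] /andP[/= uf /negPf->] /orP[|/eqP//] /andP[/= ug /negPf->] _ _.
  by move/(upI2 _ _ uf ug) ->.
- by move=> c _; rewrite /thr; case: eqP => [->|_]; [right|left].
Qed.

End CactusVertices.

Theorem theorem5p2 (T : finType) (eT : rel T) (N : nat)
    (len : fedge eT -> bool -> nat) :
  is_tree eT ->
  (forall f b, 2 * len f b <= N) ->
  atomic_MBD_critical (@H_adj T eT N len) (~: @XH T eT N len).
Proof.
move=> treeT lenN; split.
- split; first exact: cactus_staller_wins.
  move=> v; rewrite inE negbK in_XH // => iv.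
  have [m [mA mI]] := matching_exists lenN treeT iv.
  have inP x : x \in ~: (v |: ~: XH N len) -> in_class x /\ x <> v.
    by rewrite !in_setC in_setU1 in_setC negb_or negbK in_XH // => /andP[/eqP].
  apply: (@pairing_dominator_wins _ _ _ m).
  + by move=> x y /inP[ix xv] /inP[iy yv]; apply: mI.
  + move=> x /inP[ix xv]; rewrite in_setU1 in_setC in_XH //.
    by rewrite (in_class_adj (mA x ix xv)) ix orbT.
  + by move=> x /inP[ix xv]; apply: mA.
- move=> u w; rewrite !in_setC !in_XH // => iu iw; apply/negP => /in_class_adj E.
  by rewrite E iu in iw.
- by move=> u; rewrite in_setC in_XH //; apply: class_compl_not_isolated.
Qed.
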